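(* Let $V$ be a locally $U$-small type with an equivalence $\sup:\mathcal{P}_U V\simeq V$, and for $x:V$ and $y\equiv\sup(A,f)$ define $x\in y:=\sum_{a:A}f\,a=x$. Then for every $x:V$ and every $P:V\to\mathrm{Prop}_U$ there is $u:V$ such that for all $z:V$, $(z\in u)\simeq (z\in x)\times P\,z$.
   Context: Homotopy type theory with a univalent universe $U$ inside a larger univalent universe $\mathrm{Type}$; $\mathrm{Prop}_U$ is the type of mere propositions in $U$. A type is locally $U$-small if each of its identity types is equivalent to a type in $U$. $A\hookrightarrow B$ denotes embeddings. $\mathcal{P}_U X:=\sum_{A:U}(A\hookrightarrow X)$. Every $y:V$ is of the form $\sup(A,f)$ since $\sup$ is an equivalence. *)

(* Defs.v *)
(** Homotopy type theory as an object language, in the style of Appendix A of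
    the HoTT book: cumulative Russell universes, dependent products and sums,
    identity types with path induction, the empty and unit types, binary sums
    and the natural numbers.

    Rocq's own types cannot play the role of homotopy types.  Identity types
    are equivalent there to the impredicative, singleton-eliminating [eq], so
    that every type is locally small, and univalence is refuted by the
    customary axioms on [Prop]. *)

From Stdlib Require Import List.
Import ListNotations.

(** * Raw terms, with de Bruijn indices *)

Inductive tm : Type :=
| tVar (k : nat)
| tUniv (l : nat)
| tPi (A B : tm)              (* B binds 1 *)
| tLam (A b : tm)             (* b binds 1 *)
| tApp (f a : tm)
| tSig (A B : tm)             (* B binds 1 *)
| tPair (a b : tm)
| tSplit (C g p : tm)         (* C binds 1, g binds 2 *)
| tId (A a b : tm)
| tRefl (a : tm)
| tJ (C d p : tm)             (* C binds 2: the right endpoint and the path *)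
| tEmpty
| tAbsurd (C a : tm)          (* C binds 1 *)
| tUnit
| tStar
| tUnitRec (C c a : tm)       (* C binds 1 *)
| tSum (A B : tm)
| tInl (a : tm)
| tInr (b : tm)
| tCase (C c d e : tm)        (* C, c, d bind 1 *)
| tNat
| tZero
| tSucc (a : tm)
| tNatRec (C c d a : tm).     (* C binds 1; d binds 2: n and the value at n *)

Definition scons {X : Type} (x : X) (s : nat -> X) (k : nat) : X :=
  match k with O => x | S k' => s k' end.

Definition upren (r : nat -> nat) : nat -> nat := scons 0 (fun k => S (r k)).

Fixpoint ren (r : nat -> nat) (t : tm) : tm :=
  let r1 := upren r in
  let r2 := upren r1 in
  match t with
  | tVar k => tVar (r k)
  | tUniv l => tUniv l
  | tPi A B => tPi (ren r A) (ren r1 B)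
  | tLam A b => tLam (ren r A) (ren r1 b)
  | tApp f a => tApp (ren r f) (ren r a)
  | tSig A B => tSig (ren r A) (ren r1 B)
  | tPair a b => tPair (ren r a) (ren r b)
  | tSplit C g p => tSplit (ren r1 C) (ren r2 g) (ren r p)
  | tId A a b => tId (ren r A) (ren r a) (ren r b)
  | tRefl a => tRefl (ren r a)
  | tJ C d p => tJ (ren r2 C) (ren r d) (ren r p)
  | tEmpty => tEmpty
  | tAbsurd C a => tAbsurd (ren r1 C) (ren r a)
  | tUnit => tUnit
  | tStar => tStar
  | tUnitRec C c a => tUnitRec (ren r1 C) (ren r c) (ren r a)
  | tSum A B => tSum (ren r A) (ren r B)
  | tInl a => tInl (ren r a)
  | tInr b => tInr (ren r b)
  | tCase C c d e => tCase (ren r1 C) (ren r1 c) (ren r1 d) (ren r e)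
  | tNat => tNat
  | tZero => tZero
  | tSucc a => tSucc (ren r a)
  | tNatRec C c d a => tNatRec (ren r1 C) (ren r c) (ren r2 d) (ren r a)
  end.

Definition up (s : nat -> tm) : nat -> tm :=
  scons (tVar 0) (fun k => ren S (s k)).

Fixpoint subst (s : nat -> tm) (t : tm) : tm :=
  let s1 := up s in
  let s2 := up s1 in
  match t with
  | tVar k => s k
  | tUniv l => tUniv l
  | tPi A B => tPi (subst s A) (subst s1 B)
  | tLam A b => tLam (subst s A) (subst s1 b)
  | tApp f a => tApp (subst s f) (subst s a)
  | tSig A B => tSig (subst s A) (subst s1 B)
  | tPair a b => tPair (subst s a) (subst s b)
  | tSplit C g p => tSplit (subst s1 C) (subst s2 g) (subst s p)
  | tId A a b => tId (subst s A) (subst s a) (subst s b)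
  | tRefl a => tRefl (subst s a)
  | tJ C d p => tJ (subst s2 C) (subst s d) (subst s p)
  | tEmpty => tEmpty
  | tAbsurd C a => tAbsurd (subst s1 C) (subst s a)
  | tUnit => tUnit
  | tStar => tStar
  | tUnitRec C c a => tUnitRec (subst s1 C) (subst s c) (subst s a)
  | tSum A B => tSum (subst s A) (subst s B)
  | tInl a => tInl (subst s a)
  | tInr b => tInr (subst s b)
  | tCase C c d e => tCase (subst s1 C) (subst s1 c) (subst s1 d) (subst s e)
  | tNat => tNat
  | tZero => tZero
  | tSucc a => tSucc (subst s a)
  | tNatRec C c d a => tNatRec (subst s1 C) (subst s c) (subst s2 d) (subst s a)
  end.

(** [subst1 a t] is [t[a/0]]; [subst2 a b t] is [t[a/1, b/0]]. *)
Definition subst1 (a t : tm) : tm := subst (scons a tVar) t.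
Definition subst2 (a b t : tm) : tm := subst (scons b (scons a tVar)) t.

(** * Judgmental equality

    As in Luo's ECC, conversion is defined on raw terms and typing is checked
    at its endpoints by [ty_conv].  It is generated by the computation rules
    alone: the uniqueness principle for functions is not included.  As
    everything below is a derivability claim, it persists in theories with
    more judgmental equalities or more type formers. *)

Inductive conv : tm -> tm -> Prop :=
| conv_beta A b a : conv (tApp (tLam A b) a) (subst1 a b)
| conv_split C g a b : conv (tSplit C g (tPair a b)) (subst2 a b g)
| conv_J C d a : conv (tJ C d (tRefl a)) d
| conv_unit C c : conv (tUnitRec C c tStar) c
| conv_inl C c d a : conv (tCase C c d (tInl a)) (subst1 a c)
| conv_inr C c d b : conv (tCase C c d (tInr b)) (subst1 b d)
| conv_zero C c d : conv (tNatRec C c d tZero) c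
| conv_succ C c d n :
    conv (tNatRec C c d (tSucc n)) (subst2 n (tNatRec C c d n) d)
| conv_refl t : conv t t
| conv_sym t u : conv t u -> conv u t
| conv_trans t u v : conv t u -> conv u v -> conv t v
| cong_Pi A A' B B' : conv A A' -> conv B B' -> conv (tPi A B) (tPi A' B')
| cong_Lam A A' b b' : conv A A' -> conv b b' -> conv (tLam A b) (tLam A' b')
| cong_App f f' a a' : conv f f' -> conv a a' -> conv (tApp f a) (tApp f' a')
| cong_Sig A A' B B' : conv A A' -> conv B B' -> conv (tSig A B) (tSig A' B')
| cong_Pair a a' b b' :
    conv a a' -> conv b b' -> conv (tPair a b) (tPair a' b')
| cong_Split C C' g g' p p' :
    conv C C' -> conv g g' -> conv p p' -> conv (tSplit C g p) (tSplit C' g' p')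
| cong_Id A A' a a' b b' :
    conv A A' -> conv a a' -> conv b b' -> conv (tId A a b) (tId A' a' b')
| cong_Refl a a' : conv a a' -> conv (tRefl a) (tRefl a')
| cong_J C C' d d' p p' :
    conv C C' -> conv d d' -> conv p p' -> conv (tJ C d p) (tJ C' d' p')
| cong_Absurd C C' a a' :
    conv C C' -> conv a a' -> conv (tAbsurd C a) (tAbsurd C' a')
| cong_UnitRec C C' c c' a a' :
    conv C C' -> conv c c' -> conv a a' ->
    conv (tUnitRec C c a) (tUnitRec C' c' a')
| cong_Sum A A' B B' : conv A A' -> conv B B' -> conv (tSum A B) (tSum A' B')
| cong_Inl a a' : conv a a' -> conv (tInl a) (tInl a')
| cong_Inr b b' : conv b b' -> conv (tInr b) (tInr b')
| cong_Case C C' c c' d d' e e' :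
    conv C C' -> conv c c' -> conv d d' -> conv e e' ->
    conv (tCase C c d e) (tCase C' c' d' e')
| cong_Succ a a' : conv a a' -> conv (tSucc a) (tSucc a')
| cong_NatRec C C' c c' d d' a a' :
    conv C C' -> conv c c' -> conv d d' -> conv a a' ->
    conv (tNatRec C c d a) (tNatRec C' c' d' a').

(** * Typing

    The head of a context is its most recent entry; entry [k] lives in the
    context formed by the entries after it. *)

Inductive wf_ctx : list tm -> Prop :=
| wf_nil : wf_ctx []
| wf_cons G A i : wf_ctx G -> has_type G A (tUniv i) -> wf_ctx (A :: G)

with has_type : list tm -> tm -> tm -> Prop :=
| ty_var G k A :
    wf_ctx G -> nth_error G k = Some A ->
    has_type G (tVar k) (ren (Nat.add (S k)) A)
| ty_conv G t A B i :
    has_type G t A -> has_type G B (tUniv i) -> conv A B -> has_type G t B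
| ty_univ G i : wf_ctx G -> has_type G (tUniv i) (tUniv (S i))
| ty_cumul G A i : has_type G A (tUniv i) -> has_type G A (tUniv (S i))

| ty_Pi G A B i :
    has_type G A (tUniv i) -> has_type (A :: G) B (tUniv i) ->
    has_type G (tPi A B) (tUniv i)
| ty_Lam G A B b :
    has_type (A :: G) b B -> has_type G (tLam A b) (tPi A B)
| ty_App G A B f a :
    has_type G f (tPi A B) -> has_type G a A ->
    has_type G (tApp f a) (subst1 a B)

| ty_Sig G A B i :
    has_type G A (tUniv i) -> has_type (A :: G) B (tUniv i) ->
    has_type G (tSig A B) (tUniv i)
| ty_Pair G A B a b i :
    has_type (A :: G) B (tUniv i) ->
    has_type G a A -> has_type G b (subst1 a B) ->
    has_type G (tPair a b) (tSig A B)
| ty_Split G A B C g p i :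
    has_type (tSig A B :: G) C (tUniv i) ->
    has_type (B :: A :: G) g
      (subst (scons (tPair (tVar 1) (tVar 0)) (fun k => tVar (S (S k)))) C) ->
    has_type G p (tSig A B) ->
    has_type G (tSplit C g p) (subst1 p C)

| ty_Id G A a b i :
    has_type G A (tUniv i) -> has_type G a A -> has_type G b A ->
    has_type G (tId A a b) (tUniv i)
| ty_Refl G A a : has_type G a A -> has_type G (tRefl a) (tId A a a)
| ty_J G A a b C d p i :
    has_type (tId (ren S A) (ren S a) (tVar 0) :: A :: G) C (tUniv i) ->
    has_type G d (subst2 a (tRefl a) C) ->
    has_type G b A -> has_type G p (tId A a b) ->
    has_type G (tJ C d p) (subst2 b p C)

| ty_Empty G i : wf_ctx G -> has_type G tEmpty (tUniv i)
| ty_Absurd G C a i :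
    has_type (tEmpty :: G) C (tUniv i) -> has_type G a tEmpty ->
    has_type G (tAbsurd C a) (subst1 a C)

| ty_Unit G i : wf_ctx G -> has_type G tUnit (tUniv i)
| ty_Star G : wf_ctx G -> has_type G tStar tUnit
| ty_UnitRec G C c a i :
    has_type (tUnit :: G) C (tUniv i) ->
    has_type G c (subst1 tStar C) -> has_type G a tUnit ->
    has_type G (tUnitRec C c a) (subst1 a C)

| ty_Sum G A B i :
    has_type G A (tUniv i) -> has_type G B (tUniv i) ->
    has_type G (tSum A B) (tUniv i)
| ty_Inl G A B a i :
    has_type G B (tUniv i) -> has_type G a A -> has_type G (tInl a) (tSum A B)
| ty_Inr G A B b i :
    has_type G A (tUniv i) -> has_type G b B -> has_type G (tInr b) (tSum A B)
| ty_Case G A B C c d e i :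
    has_type (tSum A B :: G) C (tUniv i) ->
    has_type (A :: G) c
      (subst (scons (tInl (tVar 0)) (fun k => tVar (S k))) C) ->
    has_type (B :: G) d
      (subst (scons (tInr (tVar 0)) (fun k => tVar (S k))) C) ->
    has_type G e (tSum A B) ->
    has_type G (tCase C c d e) (subst1 e C)

| ty_Nat G i : wf_ctx G -> has_type G tNat (tUniv i)
| ty_Zero G : wf_ctx G -> has_type G tZero tNat
| ty_Succ G a : has_type G a tNat -> has_type G (tSucc a) tNat
| ty_NatRec G C c d a i :
    has_type (tNat :: G) C (tUniv i) ->
    has_type G c (subst1 tZero C) ->
    has_type (C :: tNat :: G) d
      (subst (scons (tSucc (tVar 1)) (fun k => tVar (S (S k)))) C) ->
    has_type G a tNat ->
    has_type G (tNatRec C c d a) (subst1 a C).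

(** The closed type [A] has an element. *)
Definition derivable (A : tm) : Prop := exists t : tm, has_type [] t A.

(** * Named syntax

    A term is given as a function of the length [n] of the context it is used
    in, so that weakening is implicit.  The variable bound at length [n] is,
    in a context of length [m], the index [m - S n]. *)

Definition term := nat -> tm.

Definition bind (F : term -> term) : term :=
  fun n => F (fun m => tVar (m - S n)) (S n).
Definition bind2 (F : term -> term -> term) : term :=
  fun n => F (fun m => tVar (m - S n)) (fun m => tVar (m - S (S n))) (S (S n)).

Definition Univ (l : nat) : term := fun _ => tUniv l.
Definition Pi (A : term) (B : term -> term) : term :=
  fun n => tPi (A n) (bind B n).
Definition Lam (A : term) (b : term -> term) : term :=
  fun n => tLam (A n) (bind b n).
Definition App (f a : term) : term := fun n => tApp (f n) (a n).
Definition Sig (A : term) (B : term -> term) : term :=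
  fun n => tSig (A n) (bind B n).
Definition Pair (a b : term) : term := fun n => tPair (a n) (b n).
Definition Split (C : term -> term) (g : term -> term -> term) (p : term) : term :=
  fun n => tSplit (bind C n) (bind2 g n) (p n).
Definition Id (A a b : term) : term := fun n => tId (A n) (a n) (b n).
Definition Refl (a : term) : term := fun n => tRefl (a n).
Definition J (C : term -> term -> term) (d p : term) : term :=
  fun n => tJ (bind2 C n) (d n) (p n).

Definition closed (A : term) : tm := A 0.

Declare Scope hott_scope.
Delimit Scope hott_scope with hott.
Bind Scope hott_scope with term.

Notation "'Π' x : A , B" := (Pi A (fun x => B))
  (at level 200, x name, A at level 99, B at level 200) : hott_scope.
Notation "'Σ' x : A , B" := (Sig A (fun x => B))
  (at level 200, x name, A at level 99, B at level 200) : hott_scope.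
Notation "'λ' x : A , b" := (Lam A (fun x => b))
  (at level 200, x name, A at level 99, b at level 200) : hott_scope.
Notation "A ⟶ B" := (Pi A (fun _ => B))
  (at level 90, right associativity) : hott_scope.
Notation "A × B" := (Sig A (fun _ => B))
  (at level 40, left associativity) : hott_scope.
Notation "f · a" := (App f a) (at level 20, left associativity) : hott_scope.
Notation "⟨ a , b ⟩" := (Pair a b) (at level 0) : hott_scope.

Open Scope hott_scope.

(** Projections of [p : Σ x : A, B x]; the types are needed for the motives. *)
Definition pr1 (A : term) (p : term) : term :=
  Split (fun _ => A) (fun a _ => a) p.
Definition pr2 (A : term) (B : term -> term) (p : term) : term :=
  Split (fun w => B (pr1 A w)) (fun _ b => b) p.

(** * Propositions, equivalences, embeddings, univalence *)

Definition isContr (A : term) : term := Σ c : A, Π x : A, Id A c x.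
Definition isProp (A : term) : term := Π x : A, Π y : A, Id A x y.

Definition fiber (A B f b : term) : term := Σ a : A, Id B (f · a) b.

Definition isEquiv (A B f : term) : term := Π b : B, isContr (fiber A B f b).
Definition Equiv (A B : term) : term := Σ f : A ⟶ B, isEquiv A B f.

Definition inverse (A B e b : term) : term :=
  pr1 A
    (pr1 (fiber A B (pr1 (A ⟶ B) e) b)
       (pr2 (A ⟶ B) (fun f => isEquiv A B f) e · b)).

(** For [p : Id A x _]. *)
Definition ap (A B f x p : term) : term :=
  J (fun y _ => Id B (f · x) (f · y)) (Refl (f · x)) p.

Definition isEmb (A B f : term) : term :=
  Π x : A, Π y : A,
    isEquiv (Id A x y) (Id B (f · x) (f · y)) (λ p : Id A x y, ap A B f x p).
Definition Emb (A B : term) : term := Σ f : A ⟶ B, isEmb A B f.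

Definition idEquiv (A : term) : term :=
  let fib b := fiber A A (λ x : A, x) b in
  ⟨λ x : A, x,
   λ b : A,
     ⟨⟨b, Refl b⟩,
      λ w : fib b,
        Split (fun w => Id (fib b) ⟨b, Refl b⟩ w)
          (fun x p =>
             J (fun y q => Id (fib y) ⟨y, Refl y⟩ ⟨x, q⟩) (Refl ⟨x, Refl x⟩) p)
          w⟩⟩.

(** For [p : Id (Univ l) A _]. *)
Definition idToEquiv (A p : term) : term :=
  J (fun B _ => Equiv A B) (idEquiv A) p.

Definition univalence (l : nat) : term :=
  Π A : Univ l, Π B : Univ l,
    isEquiv (Id (Univ l) A B) (Equiv A B)
      (λ p : Id (Univ l) A B, idToEquiv A p).

(** * Material set theory over a universe [U] *)

Definition PropU (U : term) : term := Σ Q : U, isProp Q.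

Definition locallySmall (U V : term) : term :=
  Π x : V, Π y : V, Σ B : U, Equiv (Id V x y) B.

Definition PowU (U X : term) : term := Σ A : U, Emb A X.

(** For [y] equal to [sup ⟨A, f⟩], the type [Σ a : A, Id V (f · a) x]. *)
Definition mem (U V sup x y : term) : term :=
  let w := inverse (PowU U V) V sup y in
  let A := pr1 U w in
  let f := pr1 (A ⟶ V) (pr2 U (fun A => Emb A V) w) in
  Σ a : A, Id V (f · a) x.

(* Main.v *)
(** If [x] is [sup (A, f)], take [u := sup (Σ a : A, P (f a), f ∘ pr1)].  That
    [f ∘ pr1] is again an embedding follows from the fundamental theorem of
    identity types: any path [f a = f b] is [ap f t] for some [t : a = b], and
    path induction on [t], then propositionality of [P], contracts the total
    space of [Id V (f a) (f (pr1 q))].  The fibre of [f ∘ pr1] over [z] is the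
    fibre of [f] over [z] times [P z], and membership in [sup w] is the fibre of
    [w] because the inverse of [sup] sends [sup w] to [w] up to a path.

    The derivations are found by evaluating a verified bidirectional type
    checker on explicit proof terms, at the universe levels 0 and 1; a strictly
    increasing relabelling of levels preserves typing and carries 0, 1 to
    [i], [j]. *)

From Stdlib Require Import List Arith Lia Bool.
Require Import Defs.
Import ListNotations.

(** * Substitution calculus *)

Lemma upren_ext r r' : (forall k, r k = r' k) -> forall k, upren r k = upren r' k.
Proof. intros H [|k]; cbn; auto. Qed.

Lemma up_ext s s' : (forall k, s k = s' k) -> forall k, up s k = up s' k.
Proof. intros H [|k]; cbn; rewrite ?H; auto. Qed.

Lemma ren_ext t : forall r r', (forall k, r k = r' k) -> ren r t = ren r' t.
Proof. induction t; intros; cbn; f_equal; auto 6 using upren_ext. Qed.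

Lemma subst_ext t : forall s s', (forall k, s k = s' k) -> subst s t = subst s' t.
Proof. induction t; intros; cbn; f_equal; auto 6 using up_ext. Qed.

Lemma up_tVar r k : up (fun k => tVar (r k)) k = tVar (upren r k).
Proof. destruct k; reflexivity. Qed.

(** Renamings are substitutions by variables, so laws about [ren] can be read off from laws about
    [subst], as in [ren_ren]. *)
Lemma ren_as_subst t : forall r, ren r t = subst (fun k => tVar (r k)) t.
Proof.
  assert (H2 : forall r k, up (up (fun k => tVar (r k))) k = tVar (upren (upren r) k)).
  { intros r k. rewrite (up_ext _ _ (up_tVar r)). apply up_tVar. }
  induction t; intros r; cbn; f_equal; auto;
    match goal with IH : forall r, ren r ?t = _ |- ren _ ?t = _ => rewrite IH end;
    apply subst_ext; intros k; symmetry; auto using up_tVar.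
Qed.

(** Binders dictate the order [subst_ren], [ren_subst], [subst_subst]: moving a composite past [up]
    uses the laws already proved. *)
Lemma subst_ren t : forall r s, subst s (ren r t) = subst (fun k => s (r k)) t.
Proof.
  assert (H1 : forall r s k, up s (upren r k) = up (fun k => s (r k)) k)
    by (intros r s [|k]; reflexivity).
  assert (H2 : forall r s k,
            up (up s) (upren (upren r) k) = up (up (fun k => s (r k))) k).
  { intros r s k. rewrite H1. apply up_ext, H1. }
  induction t; intros r s; cbn; f_equal; auto;
    match goal with IH : forall r s, subst s (ren r ?t) = _ |- subst _ (ren _ ?t) = _ =>
      rewrite IH end; apply subst_ext; auto.
Qed.

Lemma ren_ren t r r' : ren r' (ren r t) = ren (fun k => r' (r k)) t.
Proof. rewrite !(ren_as_subst _ r'), subst_ren, ren_as_subst. reflexivity. Qed.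

Lemma ren_subst t : forall r s, ren r (subst s t) = subst (fun k => ren r (s k)) t.
Proof.
  assert (H1 : forall r s k, ren (upren r) (up s k) = up (fun k => ren r (s k)) k).
  { intros r s [|k]; cbn; [reflexivity|]. rewrite !ren_ren. reflexivity. }
  assert (H2 : forall r s k,
            ren (upren (upren r)) (up (up s) k) = up (up (fun k => ren r (s k))) k).
  { intros r s k. rewrite H1. apply up_ext, H1. }
  induction t; intros r s; cbn; f_equal; auto;
    match goal with IH : forall r s, ren r (subst s ?t) = _ |- ren _ (subst _ ?t) = _ =>
      rewrite IH end; apply subst_ext; auto.
Qed.

Lemma subst_up_ren s t : subst (up s) (ren S t) = ren S (subst s t).
Proof. rewrite subst_ren, ren_subst. reflexivity. Qed.

Lemma subst_subst t : forall s s', subst s' (subst s t) = subst (fun k => subst s' (s k)) t.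
Proof.
  assert (H1 : forall s s' k, subst (up s') (up s k) = up (fun k => subst s' (s k)) k).
  { intros s s' [|k]; cbn; [reflexivity|]. apply subst_up_ren. }
  assert (H2 : forall s s' k,
            subst (up (up s')) (up (up s) k) = up (up (fun k => subst s' (s k))) k).
  { intros s s' k. rewrite H1. apply up_ext, H1. }
  induction t; intros s s'; cbn; f_equal; auto;
    match goal with IH : forall s s', subst s' (subst s ?t) = _ |- subst _ (subst _ ?t) = _ =>
      rewrite IH end; apply subst_ext; auto.
Qed.

Lemma up_id k : up tVar k = tVar k.
Proof. destruct k; reflexivity. Qed.

Lemma subst_id t : subst tVar t = t.
Proof.
  assert (H2 : forall k, up (up tVar) k = tVar k).
  { intros k. rewrite (up_ext _ _ up_id). apply up_id. }
  induction t; cbn; f_equal; auto;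
    match goal with IH : subst _ ?t = _ |- subst _ ?t = _ => rewrite <- IH at 2 end;
    apply subst_ext; auto using up_id.
Qed.

Lemma subst_ren_id s r t : (forall k, s (r k) = tVar k) -> subst s (ren r t) = t.
Proof. intros H. rewrite subst_ren, (subst_ext _ _ tVar H). apply subst_id. Qed.

Lemma subst1_subst s a b : subst s (subst1 a b) = subst1 (subst s a) (subst (up s) b).
Proof.
  unfold subst1. rewrite !subst_subst. apply subst_ext. intros [|k]; cbn; [reflexivity|].
  symmetry. apply subst_ren_id. reflexivity.
Qed.

Lemma subst2_subst s a b c :
  subst s (subst2 a b c) = subst2 (subst s a) (subst s b) (subst (up (up s)) c).
Proof.
  unfold subst2. rewrite !subst_subst. apply subst_ext. intros [|[|k]]; cbn; try reflexivity.
  symmetry. rewrite ren_ren. apply subst_ren_id. reflexivity.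
Qed.

(** Branch types of eliminators instantiate the motive at a constructor applied to the branch
    variables. This lemma serves [ty_Case], where one variable is bound; the next serves [ty_Split]
    and [ty_NatRec], where two are. *)
Lemma subst_scons_shift1 s a t :
  subst (up s) (subst (scons a (fun k => tVar (S k))) t) =
  subst (scons (subst (up s) a) (fun k => tVar (S k))) (subst (up s) t).
Proof.
  rewrite !subst_subst. apply subst_ext. intros [|k]; cbn; [reflexivity|].
  rewrite subst_ren, ren_as_subst. reflexivity.
Qed.

Lemma subst_scons_shift2 s a t :
  subst (up (up s)) (subst (scons a (fun k => tVar (S (S k)))) t) =
  subst (scons (subst (up (up s)) a) (fun k => tVar (S (S k)))) (subst (up s) t).
Proof.
  rewrite !subst_subst. apply subst_ext. intros [|k]; cbn; [reflexivity|].
  rewrite ren_ren, subst_ren, ren_as_subst. reflexivity.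
Qed.

Lemma conv_subst t u : conv t u -> forall s, conv (subst s t) (subst s u).
Proof.
  induction 1; intros s; cbn; rewrite ?subst1_subst, ?subst2_subst;
    try (constructor; auto; fail).
  eapply conv_trans; eauto.
Qed.

(** * Typing is closed under substitution *)

Scheme wf_ctx_mut := Induction for wf_ctx Sort Prop
  with has_type_mut := Induction for has_type Sort Prop.
Combined Scheme typing_mutind from wf_ctx_mut, has_type_mut.

Lemma has_type_wf G t A : has_type G t A -> wf_ctx G.
Proof.
  induction 1; auto.
  inversion IHhas_type; assumption.
Qed.

(* Weakening and substitution are proved by one induction over an abstract class
   of substitutions, instantiated first with renamings and then, using the
   weakening so obtained, with all well-typed substitutions. *)
Section Admissible.

Variable adm : list tm -> (nat -> tm) -> list tm -> Prop.
Hypothesis adm_wf : forall D s G, adm D s G -> wf_ctx D.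
Hypothesis adm_var : forall D s G k A, adm D s G -> nth_error G k = Some A ->
  has_type D (s k) (subst s (ren (Nat.add (S k)) A)).
Hypothesis adm_up : forall D s G A i, adm D s G -> has_type D (subst s A) (tUniv i) ->
  adm (subst s A :: D) (up s) (A :: G).

Lemma adm_up_eq D s G A A' i :
  adm D s G -> has_type D (subst s A) (tUniv i) -> A' = subst s A ->
  adm (A' :: D) (up s) (A :: G).
Proof. intros ? ? ->. eauto. Qed.

Fixpoint ctx_preserved (G : list tm) : Prop :=
  match G with
  | [] => True
  | A :: G' => ctx_preserved G' /\
      exists i, forall D s, adm D s G' -> has_type D (subst s A) (tUniv i)
  end.

Ltac ih :=
  match goal with
  | IH : forall D s, adm D s ?G -> has_type D (subst s ?t) _ |- has_type _ (subst _ ?t) _ =>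
      eapply IH; ih
  | IH : forall D s, adm D s ?G -> has_type D _ _ |- has_type _ _ _ => eapply IH; ih
  | |- adm _ (up _) _ => eapply adm_up_eq; [ih | ih | reflexivity]
  | |- adm _ _ _ => eassumption
  end.

(* [ctx_preserved] is carried along because [ty_Lam] has no premise on the
   domain: its typing is only found inside the derivation for the body. *)
Lemma typing_preserved :
  (forall G, wf_ctx G -> ctx_preserved G) /\
  (forall G t A, has_type G t A -> ctx_preserved G /\
     forall D s, adm D s G -> has_type D (subst s t) (subst s A)).
Proof.
  apply (typing_mutind (fun G _ => ctx_preserved G)
    (fun G t A _ => ctx_preserved G /\
     forall D s, adm D s G -> has_type D (subst s t) (subst s A))).
  all: cbn; intros;
    repeat match goal with H : _ /\ _ |- _ => destruct H end;
    (split; [assumption|]) || idtac; intros.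
  all: repeat match goal with H : exists i, _ |- _ => destruct H end.
  all: rewrite ?subst1_subst, ?subst2_subst.
  all: try (econstructor; eauto using conv_subst; fail).
  - apply (adm_var _ _ _ _ _ H0 e).
  - apply ty_Pair with (i := i); [| |rewrite <- subst1_subst]; ih.
  - apply ty_Split with (A := subst s A) (B := subst (up s) B) (i := i); [ih| |ih].
    pose proof (subst_scons_shift2 s (tPair (tVar 1) (tVar 0)) C) as E.
    cbn in E. rewrite <- E. ih.
  - apply ty_J with (A := subst s A) (a := subst s a) (i := i);
      [rewrite <- !subst_up_ren; ih
      | change (tRefl (subst s a)) with (subst s (tRefl a)); rewrite <- subst2_subst; ih
      | ih | ih].
  - apply ty_Absurd with (i := i); ih.
  - apply ty_UnitRec with (i := i);
      [ih | change tStar with (subst s tStar); rewrite <- subst1_subst; ih | ih].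
  - apply ty_Case with (A := subst s A) (B := subst s B) (i := i); [ih| | |ih].
    + pose proof (subst_scons_shift1 s (tInl (tVar 0)) C) as E.
      cbn in E. rewrite <- E. ih.
    + pose proof (subst_scons_shift1 s (tInr (tVar 0)) C) as E.
      cbn in E. rewrite <- E. ih.
  - apply ty_NatRec with (i := i);
      [ih | change tZero with (subst s tZero); rewrite <- subst1_subst; ih | | ih].
    pose proof (subst_scons_shift2 s (tSucc (tVar 1)) C) as E.
    cbn in E. rewrite <- E. ih.
  Unshelve. all: exact 0.
Qed.

End Admissible.

(** Renamings are presented as substitutions with variables as values so that [typing_preserved]
    applies. Going under a binder only shifts these variables, which [ty_var] types directly, so
    weakening can be derived first; [wf_subst_up] then relies on it. *)
Definition adm_ren (D : list tm) (s : nat -> tm) (G : list tm) : Prop :=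
  wf_ctx D /\ forall k A, nth_error G k = Some A ->
    exists m A', s k = tVar m /\ nth_error D m = Some A' /\
      ren (Nat.add (S m)) A' = subst s (ren (Nat.add (S k)) A).

Lemma ren_add_S k A : ren (Nat.add (S k)) A = ren S (ren (Nat.add k) A).
Proof. rewrite ren_ren. reflexivity. Qed.

Lemma ren_add_1 A : ren (Nat.add 1) A = ren S A.
Proof. reflexivity. Qed.

Lemma has_type_subst_ren G t A D s :
  has_type G t A -> adm_ren D s G -> has_type D (subst s t) (subst s A).
Proof.
  intros Ht. revert D s.
  refine (proj2 (proj2 (typing_preserved adm_ren _ _ _) _ _ _ Ht)); clear.
  - intros D s G [H _]. exact H.
  - intros D s G k A [HD H] Hk. destruct (H _ _ Hk) as (m & A' & -> & Hm & <-).
    constructor; assumption.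
  - intros D s G A i [HD H] HA. split; [econstructor; eauto|].
    intros [|k] B Hk; cbn in Hk.
    + injection Hk as <-. exists 0, (subst s A). rewrite !ren_add_1, subst_up_ren. auto.
    + destruct (H _ _ Hk) as (m & A' & E & Hm & E').
      exists (S m), A'. cbn [up scons]. rewrite E, ren_add_S, E', (ren_add_S (S k)), subst_up_ren.
      auto.
Qed.

Lemma has_type_weaken G t A B i :
  has_type G t A -> has_type G B (tUniv i) -> has_type (B :: G) (ren S t) (ren S A).
Proof.
  intros Ht HB. rewrite !(ren_as_subst _ S). apply (has_type_subst_ren _ _ _ _ _ Ht).
  assert (HG : wf_ctx G) by (eapply has_type_wf; eauto).
  split; [econstructor; eauto|].
  intros k C Hk. exists (S k), C. rewrite <- ren_as_subst, <- ren_add_S. auto.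
Qed.

Definition wf_subst (D : list tm) (s : nat -> tm) (G : list tm) : Prop :=
  wf_ctx D /\ forall k A, nth_error G k = Some A ->
    has_type D (s k) (subst s (ren (Nat.add (S k)) A)).

Lemma wf_subst_up D s G A i :
  wf_subst D s G -> has_type D (subst s A) (tUniv i) ->
  wf_subst (subst s A :: D) (up s) (A :: G).
Proof.
  intros [HD H] HA.
  assert (HD' : wf_ctx (subst s A :: D)) by (econstructor; eauto).
  split; [assumption|].
  intros [|k] B Hk; cbn in Hk.
  - injection Hk as <-. rewrite ren_add_1, subst_up_ren. apply (ty_var _ 0); auto.
  - rewrite ren_add_S, subst_up_ren. eapply has_type_weaken; eauto.
Qed.

Theorem has_type_subst G t A D s :
  has_type G t A -> wf_subst D s G -> has_type D (subst s t) (subst s A).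
Proof.
  intros Ht. revert D s.
  refine (proj2 (proj2 (typing_preserved wf_subst _ _ _) _ _ _ Ht)); clear.
  - intros D s G [H _]. exact H.
  - intros D s G k A [HD H]. apply H.
  - apply wf_subst_up.
Qed.

Lemma wf_subst_id G : wf_ctx G -> wf_subst G tVar G.
Proof. intros HG. split; [assumption|]. intros. rewrite subst_id. constructor; auto. Qed.

Lemma wf_subst_scons D s G a A :
  wf_subst D s G -> has_type D a (subst s A) -> wf_subst D (scons a s) (A :: G).
Proof.
  intros [HD H] Ha. split; [assumption|].
  intros [|k] B Hk; cbn in Hk; rewrite subst_ren.
  - injection Hk as <-. exact Ha.
  - specialize (H _ _ Hk). rewrite subst_ren in H. exact H.
Qed.

Lemma wf_subst_shift D G :
  wf_ctx (D ++ G) -> wf_subst (D ++ G) (fun k => tVar (length D + k)) G.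
Proof.
  intros HG. split; [assumption|]. intros k A Hk.
  rewrite <- ren_as_subst, ren_ren.
  rewrite (ren_ext _ _ (Nat.add (S (length D + k)))) by (intros; lia).
  apply ty_var; [assumption|]. rewrite nth_error_app2, Nat.add_comm, Nat.add_sub by lia.
  assumption.
Qed.

Lemma has_type_subst1 G A a t T :
  has_type (A :: G) t T -> has_type G a A -> has_type G (subst1 a t) (subst1 a T).
Proof.
  intros Ht Ha. apply (has_type_subst _ _ _ _ _ Ht).
  apply wf_subst_scons; [apply wf_subst_id; eapply has_type_wf; eauto|].
  rewrite subst_id. exact Ha.
Qed.

Lemma has_type_subst2 G A B a b t T :
  has_type (B :: A :: G) t T -> has_type G a A -> has_type G b (subst1 a B) ->
  has_type G (subst2 a b t) (subst2 a b T).
Proof.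
  intros Ht Ha Hb. apply (has_type_subst _ _ _ _ _ Ht).
  repeat apply wf_subst_scons; [apply wf_subst_id; eapply has_type_wf; eauto| |exact Hb].
  rewrite subst_id. exact Ha.
Qed.

(** * Inversion and validity of types *)

Definition is_type (G : list tm) (A : tm) : Prop := exists i, has_type G A (tUniv i).

Lemma is_type_le G A i k : has_type G A (tUniv i) -> i <= k -> has_type G A (tUniv k).
Proof. induction 2; auto using ty_cumul. Qed.

Lemma is_type_nth G k A :
  wf_ctx G -> nth_error G k = Some A -> is_type G (ren (Nat.add (S k)) A).
Proof.
  revert k. induction G as [|B G IH]; intros [|k] HG Hk; try discriminate;
    cbn in Hk; inversion HG; subst.
  - injection Hk as <-. rewrite ren_add_1. exists i. eapply (has_type_weaken _ _ (tUniv i)); eauto.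
  - destruct (IH _ ltac:(assumption) Hk) as [l Hl]. rewrite ren_add_S. exists l.
    eapply (has_type_weaken _ _ (tUniv l)); eauto.
Qed.

Lemma subst1_Id A a b : subst1 b (tId (ren S A) (ren S a) (tVar 0)) = tId A a b.
Proof. unfold subst1. cbn. rewrite !(subst_ren_id (scons b tVar) S); auto. Qed.

(** [ty_conv] and [ty_cumul] change only the type of the subject, so once that type is generalised
    the induction passes through them. *)
Lemma is_type_Pi_inv G A B : is_type G (tPi A B) -> is_type G A /\ is_type (A :: G) B.
Proof.
  intros [i H]. remember (tPi A B) as t eqn:E. revert E. generalize (tUniv i) H.
  clear H. induction 1; intros E; try discriminate E; auto.
  injection E as -> ->. split; eexists; eauto.
Qed.

Lemma is_type_Sig_inv G A B : is_type G (tSig A B) -> is_type G A /\ is_type (A :: G) B.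
Proof.
  intros [i H]. remember (tSig A B) as t eqn:E. revert E. generalize (tUniv i) H.
  clear H. induction 1; intros E; try discriminate E; auto.
  injection E as -> ->. split; eexists; eauto.
Qed.

Lemma is_type_Id_inv G A a b :
  is_type G (tId A a b) -> is_type G A /\ has_type G a A /\ has_type G b A.
Proof.
  intros [i H]. remember (tId A a b) as t eqn:E. revert E. generalize (tUniv i) H.
  clear H. induction 1; intros E; try discriminate E; auto.
  injection E as -> -> ->. split; eauto. eexists; eauto.
Qed.

Lemma is_type_subst1 G A a B :
  is_type (A :: G) B -> has_type G a A -> is_type G (subst1 a B).
Proof.
  intros [i H] Ha. exists i. apply (has_type_subst1 _ _ _ _ (tUniv i) H Ha).
Qed.

Lemma is_type_subst2 G A B a b C :
  is_type (B :: A :: G) C -> has_type G a A -> has_type G b (subst1 a B) ->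
  is_type G (subst2 a b C).
Proof.
  intros [i H] Ha Hb. exists i. apply (has_type_subst2 _ _ _ _ _ _ (tUniv i) H Ha Hb).
Qed.

Lemma is_type_join G H A B :
  is_type G A -> is_type H B -> exists i, has_type G A (tUniv i) /\ has_type H B (tUniv i).
Proof.
  intros [i HA] [k HB]. exists (max i k). split; eapply is_type_le; eauto; lia.
Qed.

Lemma is_type_ctx G A t B : has_type (A :: G) t B -> is_type G A.
Proof.
  intros H. apply has_type_wf in H. inversion H; subst. eexists; eauto.
Qed.

Lemma is_type_Pi G A B : is_type (A :: G) B -> is_type G (tPi A B).
Proof.
  intros HB. destruct (HB) as [k Hk].
  destruct (is_type_join _ _ _ _ (is_type_ctx _ _ _ _ Hk) HB) as (i & HA' & HB').
  exists i. constructor; assumption.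
Qed.

Lemma is_type_Sig G A B : is_type (A :: G) B -> is_type G (tSig A B).
Proof.
  intros HB. destruct (HB) as [k Hk].
  destruct (is_type_join _ _ _ _ (is_type_ctx _ _ _ _ Hk) HB) as (i & HA' & HB').
  exists i. constructor; assumption.
Qed.

Lemma is_type_Sum G A B : is_type G A -> is_type G B -> is_type G (tSum A B).
Proof.
  intros HA HB. destruct (is_type_join _ _ _ _ HA HB) as (i & HA' & HB').
  exists i. constructor; assumption.
Qed.

Lemma is_type_Id G A a b : has_type G a A -> has_type G b A -> is_type G A -> is_type G (tId A a b).
Proof. intros Ha Hb [i HA]. exists i. constructor; assumption. Qed.

(** Elimination rules carry the typing of their motive, so substitution suffices there; for [ty_App]
    the codomain is recovered by inverting the product type. The soundness proof uses this to see
    that inferred types are types. *)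
Theorem has_type_is_type G t A : has_type G t A -> is_type G A.
Proof.
  assert (Hsubst : forall G A C a i,
    has_type (A :: G) C (tUniv i) -> has_type G a A -> is_type G (subst1 a C)).
  { intros. eapply is_type_subst1; [eexists; eassumption|eassumption]. }
  assert (HU : forall G A i, has_type G A (tUniv i) -> is_type G A)
    by (intros; eexists; eassumption).
  induction 1; try (eauto using is_type_Pi, is_type_Sig, is_type_Sum, is_type_Id; fail).
  all: try (eexists; constructor; eauto using has_type_wf; fail).
  - apply is_type_nth; auto.
  - apply is_type_Pi_inv in IHhas_type1. eapply is_type_subst1; [apply IHhas_type1|auto].
  - eapply is_type_subst2; [eexists; eassumption|eassumption|].
    rewrite subst1_Id. assumption.
  Unshelve. all: exact 0.
Qed.

(** * A verified type checker for Π, Σ, identity types and universes *)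

Scheme Equality for tm.

(** When the fuel runs out the term is returned as it stands, so the result is convertible to the
    input but may fail to be normal. Convertibility is all that soundness asks for. *)
Fixpoint nf (n : nat) (t : tm) : tm :=
  match n with
  | O => t
  | S n =>
    match t with
    | tPi A B => tPi (nf n A) (nf n B)
    | tLam A b => tLam (nf n A) (nf n b)
    | tSig A B => tSig (nf n A) (nf n B)
    | tPair a b => tPair (nf n a) (nf n b)
    | tId A a b => tId (nf n A) (nf n a) (nf n b)
    | tRefl a => tRefl (nf n a)
    | tApp f a =>
        match nf n f with
        | tLam _ b => nf n (subst1 a b)
        | f' => tApp f' (nf n a)
        end
    | tSplit C g p =>
        match nf n p with
        | tPair a b => nf n (subst2 a b g)
        | p' => tSplit (nf n C) (nf n g) p'
        end
    | tJ C d p =>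
        match nf n p with
        | tRefl _ => nf n d
        | p' => tJ (nf n C) (nf n d) p'
        end
    | _ => t
    end
  end.

Lemma nf_conv n t : conv t (nf n t).
Proof.
  revert t. induction n as [|n IH]; intros t; [apply conv_refl|].
  destruct t; cbn [nf]; try (constructor; auto; fail).
  - pose proof (IH t1) as Hf.
    assert (Happ : conv (tApp t1 t2) (tApp (nf n t1) t2)) by (constructor; auto using conv_refl).
    eapply conv_trans; [exact Happ|].
    destruct (nf n t1); try (constructor; auto using conv_refl; fail).
    eapply conv_trans; [apply conv_beta|apply IH].
  - assert (Hs : conv (tSplit t1 t2 t3) (tSplit t1 t2 (nf n t3)))
      by (constructor; auto using conv_refl).
    eapply conv_trans; [exact Hs|].
    destruct (nf n t3); try (constructor; auto using conv_refl; fail).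
    eapply conv_trans; [apply conv_split|apply IH].
  - assert (Hs : conv (tJ t1 t2 t3) (tJ t1 t2 (nf n t3)))
      by (constructor; auto using conv_refl).
    eapply conv_trans; [exact Hs|].
    destruct (nf n t3); try (constructor; auto using conv_refl; fail).
    eapply conv_trans; [apply conv_J|apply IH].
Qed.

(** Soundness holds for any value; this one is large enough for the proof terms below. *)
Definition fuel : nat := 500.

Definition convb (t u : tm) : bool := tm_beq t u || tm_beq (nf fuel t) (nf fuel u).

Lemma convb_conv t u : convb t u = true -> conv t u.
Proof.
  unfold convb. rewrite orb_true_iff. intros [E|E]; apply internal_tm_dec_bl in E.
  - subst. apply conv_refl.
  - eapply conv_trans; [apply (nf_conv fuel)|]. rewrite E. apply conv_sym, nf_conv.
Qed.

(** Cumulativity is tested between universes only, because [ty_cumul] does not act inside products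
    or sums. *)
Definition subb (T A : tm) : bool :=
  match T, A with
  | tUniv k, tUniv l => k <=? l
  | _, _ => convb T A
  end.

Lemma subb_has_type G t T A :
  subb T A = true -> has_type G t T -> is_type G A -> has_type G t A.
Proof.
  intros E Ht [i HA].
  assert (H : convb T A = true -> has_type G t A)
    by (intros; eapply ty_conv; eauto using convb_conv).
  unfold subb in E. destruct T; auto. destruct A; auto.
  eapply is_type_le; eauto. apply Nat.leb_le; assumption.
Qed.

Arguments nf : simpl never.
Arguments convb : simpl never.
Arguments subb : simpl never.

(* With target [None] the type is inferred; with target [Some A] the term is
   checked against [A].  Eliminators require the inferred type of their
   principal argument to be syntactically of the right form: reducing it first
   would call for subject reduction. *)
Fixpoint tc (t : tm) (G : list tm) (o : option tm) {struct t} : option tm :=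
  let ret T :=
    match o with
    | None => Some T
    | Some A => if subb T A then Some A else None
    end in
  let check u D A := match tc u D (Some A) with Some _ => true | None => false end in
  let univ A D :=
    match tc A D None with
    | Some T => match nf fuel T with tUniv l => Some l | _ => None end
    | None => None
    end in
  let istype A D := match univ A D with Some _ => true | None => false end in
  match t with
  | tVar k =>
      match nth_error G k with Some A => ret (ren (Nat.add (S k)) A) | None => None end
  | tUniv l => ret (tUniv (S l))
  | tPi A B | tSig A B =>
      match univ A G with
      | Some k =>
          match univ B (A :: G) with Some l => ret (tUniv (max k l)) | None => None end
      | None => None
      end
  | tLam A b =>
      if istype A G then
        match o with
        | Some (tPi A' B) =>
            if convb A A' && check b (A :: G) B then o else None
        | _ =>
            match tc b (A :: G) None with Some B => ret (tPi A B) | None => None end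
        end
      else None
  | tApp f a =>
      match tc f G None with
      | Some (tPi A B) => if check a G A then ret (subst1 a B) else None
      | _ => None
      end
  | tPair a b =>
      match o with
      | Some (tSig A B) => if check a G A && check b G (subst1 a B) then o else None
      | _ => None
      end
  | tSplit C g p =>
      match tc p G None with
      | Some (tSig A B) =>
          if istype C (tSig A B :: G) &&
             check g (B :: A :: G)
               (subst (scons (tPair (tVar 1) (tVar 0)) (fun k => tVar (S (S k)))) C)
          then ret (subst1 p C) else None
      | _ => None
      end
  | tId A a b =>
      match univ A G with
      | Some l => if check a G A && check b G A then ret (tUniv l) else None
      | None => None
      end
  | tRefl a =>
      match o with
      | Some (tId A b c) => if check a G A && convb a b && convb a c then o else None
      | _ => match tc a G None with Some A => ret (tId A a a) | None => None end
      end
  | tJ C d p =>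
      match tc p G None with
      | Some (tId A a b) =>
          if istype C (tId (ren S A) (ren S a) (tVar 0) :: A :: G) &&
             check d G (subst2 a (tRefl a) C)
          then ret (subst2 b p C) else None
      | _ => None
      end
  | _ => None
  end.

(** The identity substitution is well typed between the two contexts, at variable 0 through
    [ty_conv]. This serves abstractions whose annotation is merely convertible to the expected
    domain. *)
Lemma is_type_conv_ctx G A A' B :
  is_type G A -> conv A A' -> is_type G A' -> is_type (A' :: G) B -> is_type (A :: G) B.
Proof.
  intros [i HA] Hc [i' HA'] [l HB]. exists l.
  assert (HG : wf_ctx (A :: G)) by (econstructor; eauto using has_type_wf).
  rewrite <- (subst_id B). apply (has_type_subst _ _ (tUniv l) _ _ HB).
  split; [assumption|]. intros [|k] C Hk; rewrite subst_id.
  - cbn in Hk. injection Hk as <-. rewrite ren_add_1.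
    eapply ty_conv with (i := i').
    + apply (ty_var _ 0 A); auto.
    + apply (has_type_weaken _ _ (tUniv i') _ _ HA' HA).
    + rewrite !(ren_as_subst _ S). apply conv_subst. assumption.
  - apply ty_var; auto.
Qed.

(** The target is assumed to be a type, since [ty_conv] requires it and [tc] does not examine
    targets. The last conjunct identifies the result with the target, which gives [tc_check]. *)
Definition tc_sound_at (t : tm) : Prop := forall G o T,
  wf_ctx G -> (forall A, o = Some A -> is_type G A) -> tc t G o = Some T ->
  has_type G t T /\ (forall A, o = Some A -> T = A).

Lemma tc_infer t G T : tc_sound_at t -> wf_ctx G -> tc t G None = Some T -> has_type G t T.
Proof. intros H HG E. apply (H G None T); auto. discriminate. Qed.

Lemma tc_check t G A T :
  tc_sound_at t -> is_type G A -> tc t G (Some A) = Some T -> has_type G t A.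
Proof.
  intros H HA E. destruct (H G (Some A) T) as [Ht HT]; auto.
  - destruct HA. eauto using has_type_wf.
  - intros ? [= <-]. assumption.
  - rewrite <- (HT A); auto.
Qed.

Lemma tc_univ t G T l : tc_sound_at t -> wf_ctx G -> tc t G None = Some T ->
  nf fuel T = tUniv l -> has_type G t (tUniv l).
Proof.
  intros H HG E El. eapply ty_conv.
  - eapply tc_infer; eauto.
  - constructor. assumption.
  - rewrite <- El. apply nf_conv.
Qed.

(** The substitution shifts [G] by two and sends the variable of the motive to the generic pair, so
    only the typing of that pair is at stake. *)
Lemma is_type_split_branch G A B C :
  is_type (A :: G) B -> is_type (tSig A B :: G) C ->
  is_type (B :: A :: G)
    (subst (scons (tPair (tVar 1) (tVar 0)) (fun k => tVar (S (S k)))) C).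
Proof.
  intros [k HB] [l HC]. exists l.
  assert (HD : wf_ctx (B :: A :: G)) by (econstructor; eauto using has_type_wf).
  pose proof (wf_subst_shift [B; A] G HD) as Hs.
  apply (has_type_subst _ _ (tUniv l) _ _ HC).
  apply wf_subst_scons with (1 := Hs).
  destruct (is_type_ctx _ _ _ _ HB) as [m HA].
  apply (has_type_subst _ _ (tUniv m) _ _ HA) in Hs as HA'.
  apply ty_Pair with (i := k).
  - apply (has_type_subst _ _ (tUniv k) _ _ HB). eapply wf_subst_up; eauto.
  - rewrite <- ren_as_subst. apply (ty_var _ 1); auto.
  (* Shifting [B] by two under its binder and then putting variable 1 for the first component
     amounts to weakening [B] once, which is the type of variable 0. *)
  - unfold subst1. rewrite subst_subst.
    replace (subst _ B) with (ren S B); [apply (ty_var _ 0); auto|].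
    rewrite ren_as_subst. apply subst_ext. intros [|n]; reflexivity.
Qed.

(** [scrutinee] finds the innermost test on which a run of [tc] is blocked; [step] splits on it and
    discards the outcomes in which the run fails. *)
Ltac scrutinee x :=
  match x with match ?y with _ => _ end => scrutinee y | andb ?y _ => scrutinee y | _ => x end.

Ltac step E :=
  match type of E with ?x = _ =>
    let y := scrutinee x in
    (tryif is_var y then destruct y else destruct y eqn:?);
    try discriminate E; cbn [andb] in E end.

Ltac univ := match goal with
  IH : tc_sound_at ?t, H : tc ?t _ None = Some ?T, H' : nf fuel ?T = tUniv _ |- _ =>
    apply (tc_univ _ _ _ _ IH) with (2 := H) in H'; [clear H|] end.

Theorem tc_sound t : tc_sound_at t.
Proof.
  assert (Hret : forall G t o T T',
    has_type G t T -> (forall A, o = Some A -> is_type G A) ->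
    match o with None => Some T | Some A => if subb T A then Some A else None end = Some T' ->
    has_type G t T' /\ (forall A, o = Some A -> T' = A)).
  { intros G u [A|] T T' Hu Ho E.
    - destruct (subb T A) eqn:Es; [|discriminate]. injection E as <-. split; [|congruence].
      eapply subb_has_type; eauto.
    - injection E as <-. split; [assumption|discriminate]. }
  assert (Htgt : forall G t A T,
    Some A = Some T -> has_type G t A ->
    has_type G t T /\ (forall A', Some A = Some A' -> T = A')).
  { intros G u A T [= <-] Hu. split; [assumption|congruence]. }
  induction t; intros G o T HG Ho E; cbn in E; try discriminate E.
  - step E. eapply Hret; eauto. apply (ty_var _ _ _ HG). assumption.
  - eapply Hret; eauto. constructor. assumption.
  - do 2 step E. univ; auto. do 2 step E. univ; [|econstructor; eauto].
    eapply Hret; eauto. constructor; eapply is_type_le; eauto; lia.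
  - do 2 step E. univ; auto.
    assert (HG' : wf_ctx (t1 :: G)) by (econstructor; eauto).
    (* Inference mode, which is also taken when the target is not syntactically a product. *)
    assert (Hinf : match tc t2 (t1 :: G) None with
                   | Some B => match o with
                     | None => Some (tPi t1 B)
                     | Some A => if subb (tPi t1 B) A then Some A else None end
                   | None => None end = Some T ->
                   has_type G (tLam t1 t2) T /\ (forall A : tm, o = Some A -> T = A)).
    { clear E. intros E. step E. eapply Hret; eauto. constructor.
      eapply tc_infer; eauto. }
    destruct o as [[]|]; try exact (Hinf E).
    match type of Ho with forall _, Some (tPi ?C ?D) = _ -> _ => rename C into A', D into B' end.
    destruct (convb t1 A') eqn:Ec; cbn [andb] in E; [|discriminate E]. step E.
    apply Htgt with (1 := E). specialize (Ho _ eq_refl).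
    destruct (is_type_Pi_inv _ _ _ Ho) as [HA HB]. apply convb_conv in Ec.
    (* The body is checked under the annotation [t1], so the product obtained has domain [t1] and
       must be converted to the target. *)
    destruct Ho as [i Hi]. apply ty_conv with (A := tPi t1 B') (i := i); auto.
    + constructor. eapply tc_check; eauto.
      eapply is_type_conv_ctx; eauto. eexists; eauto.
    + apply cong_Pi; auto using conv_refl.
  - do 3 step E. eapply Hret; eauto. apply tc_infer in Heqo0; auto.
    pose proof (is_type_Pi_inv _ _ _ (has_type_is_type _ _ _ Heqo0)) as [HA _].
    eapply ty_App; eauto. eapply tc_check; eauto.
  - do 2 step E. univ; auto. do 2 step E. univ; [|econstructor; eauto].
    eapply Hret; eauto. constructor; eapply is_type_le; eauto; lia.
  - destruct o as [[]|]; try discriminate E. do 2 step E.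
    apply Htgt with (1 := E). specialize (Ho _ eq_refl).
    destruct (is_type_Sig_inv _ _ _ Ho) as [HA HB].
    apply tc_check in Heqo; auto. apply tc_check in Heqo0; eauto using is_type_subst1.
    destruct HB. eapply ty_Pair; eauto.
  - do 4 step E. apply tc_infer in Heqo0; auto.
    pose proof (has_type_is_type _ _ _ Heqo0) as HS.
    destruct (is_type_Sig_inv _ _ _ HS) as [[k HA] [l' HB]]. destruct HS as [m HS].
    univ; [|econstructor; eauto].
    step E. eapply Hret; eauto. eapply ty_Split; eauto.
    eapply tc_check; eauto. apply is_type_split_branch; eexists; eauto.
  - do 2 step E. univ; auto. do 2 step E. eapply Hret; eauto.
    assert (is_type G t1) by (eexists; eauto).
    constructor; eauto using tc_check.
  - assert (Hinf : match tc t G None with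
                   | Some A => match o with
                     | None => Some (tId A t t)
                     | Some B => if subb (tId A t t) B then Some B else None end
                   | None => None end = Some T ->
                   has_type G (tRefl t) T /\ (forall A : tm, o = Some A -> T = A)).
    { clear E. intros E. step E. eapply Hret; eauto. constructor.
      eapply tc_infer; eauto. }
    destruct o as [[]|]; try exact (Hinf E).
    do 3 step E. apply Htgt with (1 := E). specialize (Ho _ eq_refl).
    destruct (is_type_Id_inv _ _ _ _ Ho) as (HA & Hb & Hc). destruct Ho as [i Hi].
    eapply ty_conv; [|exact Hi|].
    + apply ty_Refl with (A := A). eapply tc_check; eauto.
    + apply cong_Id; auto using convb_conv, conv_refl.
  - do 4 step E. apply tc_infer in Heqo0; auto.
    pose proof (has_type_is_type _ _ _ Heqo0) as HI.
    destruct (is_type_Id_inv _ _ _ _ HI) as ([k HA] & Ha & Hb).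
    assert (HG' := wf_cons _ _ _ HG HA).
    univ.
    + step E. eapply Hret; eauto. eapply ty_J; eauto.
      eapply tc_check; eauto. eapply is_type_subst2; eauto.
      * eexists; eauto.
      * rewrite subst1_Id. constructor. assumption.
    + econstructor; [assumption|]. apply ty_Id with (i := k).
      * apply (has_type_weaken _ _ (tUniv k) _ _ HA HA).
      * eapply has_type_weaken; eauto.
      * apply (ty_var _ 0); auto.
Qed.

(** * Relabelling of universe levels *)

Fixpoint relevel (f : nat -> nat) (t : tm) : tm :=
  match t with
  | tVar k => tVar k
  | tUniv l => tUniv (f l)
  | tPi A B => tPi (relevel f A) (relevel f B)
  | tLam A b => tLam (relevel f A) (relevel f b)
  | tApp g a => tApp (relevel f g) (relevel f a)
  | tSig A B => tSig (relevel f A) (relevel f B)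
  | tPair a b => tPair (relevel f a) (relevel f b)
  | tSplit C g p => tSplit (relevel f C) (relevel f g) (relevel f p)
  | tId A a b => tId (relevel f A) (relevel f a) (relevel f b)
  | tRefl a => tRefl (relevel f a)
  | tJ C d p => tJ (relevel f C) (relevel f d) (relevel f p)
  | tEmpty => tEmpty
  | tAbsurd C a => tAbsurd (relevel f C) (relevel f a)
  | tUnit => tUnit
  | tStar => tStar
  | tUnitRec C c a => tUnitRec (relevel f C) (relevel f c) (relevel f a)
  | tSum A B => tSum (relevel f A) (relevel f B)
  | tInl a => tInl (relevel f a)
  | tInr b => tInr (relevel f b)
  | tCase C c d e => tCase (relevel f C) (relevel f c) (relevel f d) (relevel f e)
  | tNat => tNat
  | tZero => tZero
  | tSucc a => tSucc (relevel f a)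
  | tNatRec C c d a => tNatRec (relevel f C) (relevel f c) (relevel f d) (relevel f a)
  end.

Lemma relevel_ren f t : forall r, relevel f (ren r t) = ren r (relevel f t).
Proof. induction t; intros r; cbn; f_equal; auto. Qed.

Lemma relevel_subst f t :
  forall s, relevel f (subst s t) = subst (fun k => relevel f (s k)) (relevel f t).
Proof.
  assert (H1 : forall s k, relevel f (up s k) = up (fun k => relevel f (s k)) k).
  { intros s [|k]; cbn; [reflexivity|]. apply relevel_ren. }
  assert (H2 : forall s k, relevel f (up (up s) k) = up (up (fun k => relevel f (s k))) k).
  { intros s k. rewrite H1. apply up_ext, H1. }
  induction t; intros s; cbn; f_equal; auto;
    match goal with IH : forall s, relevel f (subst s ?t) = _ |- relevel f (subst _ ?t) = _ =>
      rewrite IH end; apply subst_ext; auto.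
Qed.

Lemma relevel_subst1 f a t : relevel f (subst1 a t) = subst1 (relevel f a) (relevel f t).
Proof. unfold subst1. rewrite relevel_subst. apply subst_ext. intros [|k]; reflexivity. Qed.

Lemma relevel_subst2 f a b t :
  relevel f (subst2 a b t) = subst2 (relevel f a) (relevel f b) (relevel f t).
Proof. unfold subst2. rewrite relevel_subst. apply subst_ext. intros [|[|k]]; reflexivity. Qed.

Lemma relevel_scons_shift f a n t :
  relevel f (subst (scons a (fun k => tVar (n k))) t) =
  subst (scons (relevel f a) (fun k => tVar (n k))) (relevel f t).
Proof. rewrite relevel_subst. apply subst_ext. intros [|k]; reflexivity. Qed.

Lemma relevel_conv f t u : conv t u -> conv (relevel f t) (relevel f u).
Proof.
  induction 1; cbn; rewrite ?relevel_subst1, ?relevel_subst2; try (constructor; auto; fail).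
  eapply conv_trans; eauto.
Qed.

(** Strictness is for [ty_univ]: [tUniv (f i)] lies in level [S (f i)], which is at most [f (S i)],
    and cumulativity covers the gap. *)
Theorem relevel_has_type f :
  (forall l, f l < f (S l)) ->
  forall G t A, has_type G t A -> has_type (map (relevel f) G) (relevel f t) (relevel f A).
Proof.
  intros Hf.
  enough (H : (forall G, wf_ctx G -> wf_ctx (map (relevel f) G)) /\
    (forall G t A, has_type G t A -> has_type (map (relevel f) G) (relevel f t) (relevel f A)))
    by apply H.
  apply (typing_mutind (fun G _ => wf_ctx (map (relevel f) G))
    (fun G t A _ => has_type (map (relevel f) G) (relevel f t) (relevel f A)));
    cbn; intros;
    rewrite ?relevel_subst1, ?relevel_subst2, ?relevel_ren in *;
    cbn in *; rewrite ?relevel_scons_shift in *.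
  all: try (econstructor; eauto using relevel_conv; fail).
  - apply (ty_var _ k); [assumption|]. apply map_nth_error. assumption.
  - eapply is_type_le with (i := S (f i)); [constructor; assumption|apply Hf].
  - eapply is_type_le; [eassumption|]. apply Nat.lt_le_incl, Hf.
Qed.

(** * Derivability of closed types by evaluation *)

Definition tc_closed (t A : tm) : bool :=
  match tc A [] None with
  | Some T =>
      match nf fuel T with
      | tUniv _ => match tc t [] (Some A) with Some _ => true | None => false end
      | _ => false
      end
  | None => false
  end.

Lemma derivable_tc t A : tc_closed t A = true -> derivable A.
Proof.
  unfold tc_closed. intros E.
  destruct (tc A [] None) as [T|] eqn:EA; [|discriminate E].
  destruct (nf fuel T) eqn:ET; try discriminate E.
  destruct (tc t [] (Some A)) eqn:Et; [|discriminate E].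
  exists t. eapply tc_check; eauto using tc_sound.
  eexists. eapply tc_univ; eauto using tc_sound, wf_nil.
Qed.

(** Lets a proof term take an earlier result as a variable, so that results are checked one at a
    time. In the uses below [B] is the closed statement [C] read in a context of length 1; its
    indices are the same as at length 0, so [reflexivity] proves the equation. *)
Lemma derivable_mp A B C :
  (forall a, subst1 a B = C) -> derivable (tPi A B) -> derivable A -> derivable C.
Proof.
  intros HC [f Hf] [a Ha]. exists (tApp f a). rewrite <- (HC a). eapply ty_App; eauto.
Qed.

Lemma derivable_relevel f A :
  (forall l, f l < f (S l)) -> derivable A -> derivable (relevel f A).
Proof. intros Hf [t Ht]. exists (relevel f t). apply (relevel_has_type f Hf [] _ _ Ht). Qed.

(** * Identity types of a type with a contractible total family *)

Notation U0 := (Univ 0).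
Notation U1 := (Univ 1).

Definition fundamentalStatement : term :=
  Π X : U1, Π x : X, Π R : X ⟶ U1, Π φ : (Π y : X, Id X x y ⟶ R · y),
  (Π w : (Σ y : X, R · y), Id (Σ y : X, R · y) ⟨x, φ · x · Refl x⟩ w) ⟶
  Π y : X, isEquiv (Id X x y) (R · y) (φ · y).

Definition fundamentalProof : term :=
  λ X : U1, λ x : X, λ R : X ⟶ U1, λ φ : (Π y : X, Id X x y ⟶ R · y),
  λ h : (Π w : (Σ y : X, R · y), Id (Σ y : X, R · y) ⟨x, φ · x · Refl x⟩ w),
  let tot := Σ y : X, R · y in
  let r0 := φ · x · Refl x in
  let x0 := ⟨x, r0⟩ in
  (* [adjust] corrects a contraction so that it is [Refl] at [x0]. *)
  let adjust w k := J (fun w' _ => Id tot w' w) k (h · x0) in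
  let fib y r := fiber (Id X x y) (R · y) (φ · y) r in
  (* The fibre over any [w] receives a point by transporting the evident one over [x0] along a path
     [k] from [x0] to [w]. *)
  let ret w k :=
    J (fun w _ => fib (pr1 X w) (pr2 X (fun y => R · y) w)) ⟨Refl x, Refl r0⟩ k in
  let center y r := ret ⟨y, r⟩ (adjust ⟨y, r⟩ (h · ⟨y, r⟩)) in
  (* [adjust w k] is [k] preceded by the inverse of [h · x0], so when [k] is [h · x0] a single path
     induction turns it into [Refl]. *)
  let adjust_refl :=
    J (fun w k => Id (Id tot w w) (J (fun w' _ => Id tot w' w) k k) (Refl w))
      (Refl (Refl x0)) (h · x0) in
  (* At [Refl x0] the term [ret] computes, so the centre over [r0] is identified with
     [⟨Refl x, Refl r0⟩]. This is the base case of the two path inductions that contract the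
     fibre. *)
  let center_refl :=
    J (fun k _ => Id (fib x r0) (center x r0) (ret x0 k)) (Refl (center x r0)) adjust_refl in
  λ y : X, λ r : R · y,
    ⟨center y r,
     λ v : fib y r,
       Split (fun v => Id (fib y r) (center y r) v)
         (fun e α =>
            J (fun r α => Id (fib y r) (center y r) ⟨e, α⟩)
              (J (fun y e => Id (fib y (φ · y · e)) (center y (φ · y · e))
                               ⟨e, Refl (φ · y · e)⟩)
                 center_refl e) α) v⟩.

Lemma fundamental : derivable (closed fundamentalStatement).
Proof. apply (derivable_tc (closed fundamentalProof)). vm_compute. reflexivity. Qed.

(** * Embeddings restricted to a subtype *)

Definition restrict (V A f : term) (Q : term -> term) : term :=
  λ p : (Σ a : A, Q a), f · pr1 A p.

Definition restrictEmbStatement : term :=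
  Π V : U1, Π A : U0, Π f : A ⟶ V, isEmb A V f ⟶ Π Q : A ⟶ PropU U0,
  isEmb (Σ a : A, pr1 U0 (Q · a)) V (restrict V A f (fun a => pr1 U0 (Q · a))).

Definition restrictEmbProof : term :=
  λ fundamental : fundamentalStatement,
  λ V : U1, λ A : U0, λ f : A ⟶ V, λ e : isEmb A V f, λ Q : A ⟶ PropU U0,
  let Q' a := pr1 U0 (Q · a) in
  let S := Σ a : A, Q' a in
  let f' := restrict V A f Q' in
  let tot p := Σ q : S, Id V (f' · p) (f' · q) in
  let apf a b t := (λ π : Id A a b, ap A V f a π) · t in
  λ p : S, λ q : S,
  fundamental · S · p · (λ q : S, Id V (f' · p) (f' · q))
    · (λ q : S, λ π : Id S p q, ap S V f' p π)
    · Split (fun p => Π w : tot p, Id (tot p) ⟨p, Refl (f' · p)⟩ w)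
        (fun a qa =>
           let p := ⟨a, qa⟩ in
           let c := ⟨p, Refl (f' · p)⟩ in
           λ w : tot p,
           Split (fun w => Id (tot p) c w)
             (fun q r =>
                (* The type of [r] depends on [q], so [r] is generalised before [q] is split; [qb]
                   is treated likewise in the induction on [t]. *)
                Split (fun q => Π r : Id V (f' · p) (f' · q), Id (tot p) c ⟨q, r⟩)
                  (fun b qb =>
                     λ r : Id V (f · a) (f · b),
                     (* As [f] is an embedding, [r] has a preimage [t] under [ap f], with [α] a path
                        from its image to [r]. *)
                     let fib := fiber (Id A a b) (Id V (f · a) (f · b))
                                  (λ π : Id A a b, ap A V f a π) r in
                     Split (fun _ => Id (tot p) c ⟨⟨b, qb⟩, r⟩)
                       (fun t α =>
                          J (fun r _ => Id (tot p) c ⟨⟨b, qb⟩, r⟩)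
                            (J (fun b t => Π qb : Q' b, Id (tot p) c ⟨⟨b, qb⟩, apf a b t⟩)
                               (λ qb : Q' a,
                                  J (fun qb _ => Id (tot p) c ⟨⟨a, qb⟩, Refl (f · a)⟩)
                                    (Refl c)
                                    (pr2 U0 (fun B => isProp B) (Q · a) · qa · qb))
                               t · qb)
                            α)
                       (pr1 fib (e · a · b · r)))
                  q · r)
             w)
        p
    · q.

Lemma restrict_emb : derivable (closed restrictEmbStatement).
Proof.
  apply (derivable_mp (closed fundamentalStatement) (restrictEmbStatement 1));
    [reflexivity| |exact fundamental].
  apply (derivable_tc (closed restrictEmbProof)). vm_compute. reflexivity.
Qed.

(** * Fibres of a restricted map *)

Definition fiberRestrictStatement : term :=
  Π V : U1, Π A : U1, Π f : A ⟶ V, Π P : V ⟶ U1, Π z : V,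
  Equiv (Σ p : (Σ a : A, P · (f · a)), Id V (restrict V A f (fun a => P · (f · a)) · p) z)
    ((Σ a : A, Id V (f · a) z) × P · z).

Definition fiberRestrictProof : term :=
  λ V : U1, λ A : U1, λ f : A ⟶ V, λ P : V ⟶ U1, λ z : V,
  (* The endpoint [z] is a parameter of every piece below, so that path induction on [r] can move
     it. *)
  let dom z := Σ p : (Σ a : A, P · (f · a)), Id V (f · pr1 A p) z in
  let cod z := (Σ a : A, Id V (f · a) z) × P · z in
  let F z :=
    λ w : dom z,
    Split (fun _ => cod z)
      (fun p r =>
         Split (fun p => Id V (f · pr1 A p) z ⟶ cod z)
           (fun a q => λ r : Id V (f · a) z,
              J (fun z _ => cod z) ⟨⟨a, Refl (f · a)⟩, q⟩ r)
           p · r)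
      w in
  let G z :=
    λ y : cod z,
    Split (fun _ => dom z)
      (fun m q =>
         Split (fun _ => dom z)
           (fun a r =>
              (* Since [q] lies over the endpoint [z], it is abstracted in the motive, and the
                 induction brings it to [P · (f · a)]. *)
              J (fun z _ => P · z ⟶ dom z)
                (λ q : P · (f · a), ⟨⟨a, q⟩, Refl (f · a)⟩) r · q)
           m)
      y in
  let ε z :=
    λ y : cod z,
    Split (fun y => Id (cod z) (F z · (G z · y)) y)
      (fun m q =>
         Split (fun m => Id (cod z) (F z · (G z · ⟨m, q⟩)) ⟨m, q⟩)
           (fun a r =>
              J (fun z r => Π q : P · z,
                   Id (cod z) (F z · (G z · ⟨⟨a, r⟩, q⟩)) ⟨⟨a, r⟩, q⟩)
                (λ q : P · (f · a), Refl ⟨⟨a, Refl (f · a)⟩, q⟩) r · q)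
           m)
      y in
  let fib z y := fiber (dom z) (cod z) (F z) y in
  let center z y := ⟨G z · y, ε z · y⟩ in
  (* By path induction, contracting the fibre over [y] need only be done at
     [⟨x, Refl⟩] over [F x], where both composites compute to the identity. *)
  let coh z x := Id (fib z (F z · x)) (center z (F z · x)) ⟨x, Refl (F z · x)⟩ in
  let η z :=
    λ x : dom z,
    Split (fun x => coh z x)
      (fun p r =>
         Split (fun p => Π r : Id V (f · pr1 A p) z, coh z ⟨p, r⟩)
           (fun a q => λ r : Id V (f · a) z,
              J (fun z r => coh z ⟨⟨a, q⟩, r⟩)
                (Refl ⟨⟨⟨a, q⟩, Refl (f · a)⟩, Refl ⟨⟨a, Refl (f · a)⟩, q⟩⟩) r)
           p · r)
      x in
  ⟨F z,
   λ y : cod z,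
     ⟨center z y,
      λ w : fib z y,
        Split (fun w => Id (fib z y) (center z y) w)
          (fun x e => J (fun y e => Id (fib z y) (center z y) ⟨x, e⟩) (η z · x) e)
          w⟩⟩.

Lemma fiber_restrict : derivable (closed fiberRestrictStatement).
Proof. apply (derivable_tc (closed fiberRestrictProof)). vm_compute. reflexivity. Qed.

(** * Separation *)

(** Membership before [sup] is applied: [mem U0 V sup z y] unfolds to [memOf V z] at the inverse
    image of [y]. *)
Definition memOf (V z w : term) : term :=
  let A := pr1 U0 w in
  let f := pr1 (A ⟶ V) (pr2 U0 (fun A => Emb A V) w) in
  Σ a : A, Id V (f · a) z.

Definition separationPowStatement : term :=
  Π V : U1, Π A : U0, Π f : A ⟶ V, isEmb A V f ⟶ Π P : V ⟶ PropU U0,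
  Σ w : PowU U0 V, Π z : V,
    Equiv (memOf V z w) ((Σ a : A, Id V (f · a) z) × pr1 U0 (P · z)).

Definition separationPowProof : term :=
  λ restrictEmb : restrictEmbStatement, λ fiberRestrict : fiberRestrictStatement,
  λ V : U1, λ A : U0, λ f : A ⟶ V, λ e : isEmb A V f, λ P : V ⟶ PropU U0,
  let Q a := pr1 U0 (P · (f · a)) in
  ⟨⟨Σ a : A, Q a,
    ⟨restrict V A f Q, restrictEmb · V · A · f · e · (λ a : A, P · (f · a))⟩⟩,
   (* Projections from the pair compute, so membership in it is convertible to the fibre of the
      restricted map. *)
   λ z : V, fiberRestrict · V · A · f · (λ v : V, pr1 U0 (P · v)) · z⟩.

Lemma separation_pow : derivable (closed separationPowStatement).
Proof.
  apply (derivable_mp (closed fiberRestrictStatement) (separationPowStatement 1));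
    [reflexivity| |exact fiber_restrict].
  apply (derivable_mp (closed restrictEmbStatement)
           ((fiberRestrictStatement ⟶ separationPowStatement) 1));
    [reflexivity| |exact restrict_emb].
  apply (derivable_tc (closed separationPowProof)). vm_compute. reflexivity.
Qed.

(** The inverse of [sup] returns [w] only up to a path. Quantifying over [T] makes the passage a
    transport, along that path, of the structure of an equivalence with [T]. *)
Definition memSupStatement : term :=
  Π V : U1, Π sup : Equiv (PowU U0 V) V, Π w : PowU U0 V, Π z : V, Π T : U1,
  Equiv (memOf V z w) T ⟶ Equiv (mem U0 V sup z (pr1 (PowU U0 V ⟶ V) sup · w)) T.

Definition memSupProof : term :=
  λ V : U1, λ sup : Equiv (PowU U0 V) V, λ w : PowU U0 V, λ z : V, λ T : U1,
  λ E : Equiv (memOf V z w) T,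
  let S := PowU U0 V in
  let s := pr1 (S ⟶ V) sup in
  let fib := fiber S V s (s · w) in
  let contr := pr2 (S ⟶ V) (fun f => isEquiv S V f) sup · (s · w) in
  let K y := Equiv (memOf V z (pr1 S y)) T in
  (* The contraction yields a path from the centre to [⟨w, Refl (s · w)⟩], while [E] has to travel
     back. Hence the motive is a function type into [K] at the centre, with the identity as base
     case. *)
  J (fun y _ => K y ⟶ K (pr1 fib contr)) (λ k : K (pr1 fib contr), k)
    (pr2 fib (fun c => Π x : fib, Id fib c x) contr · ⟨w, Refl (s · w)⟩) · E.

Lemma mem_sup : derivable (closed memSupStatement).
Proof. apply (derivable_tc (closed memSupProof)). vm_compute. reflexivity. Qed.

(** The bounding set is given as an element [w] of the powerset; taking [w] to be the inverse image
    of [x] yields separation in [x]. *)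
Definition separationFromStatement : term :=
  Π V : U1, Π sup : Equiv (PowU U0 V) V, Π w : PowU U0 V, Π P : V ⟶ PropU U0,
  Σ u : V, Π z : V,
    Equiv (mem U0 V sup z u) (memOf V z w × pr1 U0 (P · z)).

Definition separationFromProof : term :=
  λ separationPow : separationPowStatement, λ memSup : memSupStatement,
  λ V : U1, λ sup : Equiv (PowU U0 V) V, λ w : PowU U0 V, λ P : V ⟶ PropU U0,
  let S := PowU U0 V in
  let A := pr1 U0 w in
  let fe := pr2 U0 (fun A => Emb A V) w in
  let f := pr1 (A ⟶ V) fe in
  let e := pr2 (A ⟶ V) (fun f => isEmb A V f) fe in
  let M z := memOf V z w × pr1 U0 (P · z) in
  let n := separationPow · V · A · f · e · P in
  let w' := pr1 S n in
  ⟨pr1 (S ⟶ V) sup · w',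
   λ z : V, memSup · V · sup · w' · z · M z
     · (pr2 S (fun w => Π z : V, Equiv (memOf V z w) (M z)) n · z)⟩.

Lemma separation_from : derivable (closed separationFromStatement).
Proof.
  apply (derivable_mp (closed memSupStatement) (separationFromStatement 1));
    [reflexivity| |exact mem_sup].
  apply (derivable_mp (closed separationPowStatement)
           ((memSupStatement ⟶ separationFromStatement) 1));
    [reflexivity| |exact separation_pow].
  apply (derivable_tc (closed separationFromProof)). vm_compute. reflexivity.
Qed.

Definition separationStatement : term :=
  univalence 0 ⟶ univalence 1 ⟶
  Π V : U1, locallySmall U0 V ⟶
  Π sup : Equiv (PowU U0 V) V,
  Π x : V, Π P : V ⟶ PropU U0,
  Σ u : V, Π z : V,
    Equiv (mem U0 V sup z u) (mem U0 V sup z x × pr1 U0 (P · z)).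

Definition separationProof : term :=
  λ separationFrom : separationFromStatement,
  λ _ua0 : univalence 0, λ _ua1 : univalence 1,
  λ V : U1, λ _ls : locallySmall U0 V, λ sup : Equiv (PowU U0 V) V, λ x : V,
  λ P : V ⟶ PropU U0, separationFrom · V · sup · inverse (PowU U0 V) V sup x · P.

Lemma separation01 : derivable (closed separationStatement).
Proof.
  apply (derivable_mp (closed separationFromStatement) (separationStatement 1));
    [reflexivity| |exact separation_from].
  apply (derivable_tc (closed separationProof)). vm_compute. reflexivity.
Qed.

Theorem mainTheorem6 (i j : nat) (hij : i < j) :
  let U := Univ i in
  let Type_ := Univ j in
  derivable (closed (
    univalence i ⟶ univalence j ⟶
    Π V : Type_, locallySmall U V ⟶
    Π sup : Equiv (PowU U V) V,
    Π x : V, Π P : V ⟶ PropU U,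
    Σ u : V, Π z : V,
      Equiv (mem U V sup z u) (mem U V sup z x × pr1 U (P · z)))).
Proof.
  (* Level 0 goes to [i] and level [S k] to [k + j], so 1 goes to [j]; the map increases strictly
     because [i < j]. Only the levels 0 and 1 occur in the statement of [separation01]. *)
  exact (derivable_relevel (fun l => match l with 0 => i | S k => k + j end) _
           ltac:(intros [|l]; cbn; lia) separation01).
Qed.
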